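(* Let $\alpha\ge0$. Assume $(\mathrm{A}_1)$–$(\mathrm{A}_3)$ as spelled out in the context, and let $(\gamma_k)_{k\ge1}$ be a non-increasing sequence of positive regularization parameters with associated regularizations $\mathcal{R}_{\gamma_k}$ of $\mathcal{R}$, with exponent $\sigma>0$. Let $\eta>0$ and choose $M=\eta+\varepsilon^\alpha\delta_1$. Then there is a constant $C>0$, independent of $\varepsilon\in(0,1)$ and of $k$, such that the iterates $u_\varepsilon^k$ defined in the context satisfy, for all $k\ge2$ (an empty sum being $0$), $$\frac{\underline\gamma}{\eta+\delta_1+\underline\gamma C_p^{-1}}\left\|\nabla u_\varepsilon^k-\nabla u_\varepsilon^{k-1}\right\|^2_{L^2(\Omega^\varepsilon)}+\left\|u_\varepsilon^k-u_\varepsilon^{k-1}\right\|^2_{L^2(\Omega^\varepsilon)}$$ $$\le\frac{C\gamma_{k-1}^{2\sigma}}{\gamma_k}+C\sum_{j=2}^{k-1}\left(\frac{M}{\underline\gamma C_p^{-1}+M}\right)^{k-j}\frac{\gamma_{j-1}^{2\sigma}}{\gamma_j}+\left\|u_\varepsilon^1\right\|^2_{L^2(\Omega^\varepsilon)}\left(\frac{M}{\underline\gamma C_p^{-1}+M}\right)^{k-1}.$$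
   Context: Geometry. Let $d\in\{2,3\}$, $\Omega\subset\mathbb{R}^d$ a bounded polygonal (polyhedral) domain, $Y=[0,1]^d$ the periodicity cell. $Y_l\subset Y$ is the pore part of the cell, i.e. $Y$ minus a hole with Lipschitz boundary $\Gamma$. For $\varepsilon\in(0,1)$, $\Omega^\varepsilon\subset\Omega$ is the perforated domain obtained from $\Omega$ by removing $\varepsilon$-scaled, $\varepsilon$-periodically repeated copies of the hole; it is bounded, connected, and has Lipschitz boundary $\partial\Omega^\varepsilon=\Gamma^\varepsilon\cup\Gamma^{\mathrm{ext}}$, where $\Gamma^\varepsilon$ is the union of the boundaries of the removed holes and $\Gamma^{\mathrm{ext}}=\partial\Omega$ is the exterior boundary. Function space. $V^\varepsilon=\{u\in H^1(\Omega^\varepsilon):u=0\text{ on }\Gamma^{\mathrm{ext}}\}$. $C_p>0$ is a constant independent of $\varepsilon$ with $\|u\|^2_{L^2(\Omega^\varepsilon)}\le C_p\|\nabla u\|^2_{L^2(\Omega^\varepsilon)}$ for all $u\in V^\varepsilon$ (such a constant exists). Degenerate function. A function $F:\mathbb{R}\to\mathbb{R}$ is degenerate at $x_0\in\mathbb{R}$ if there is $\delta_1>0$ with $0\le F'(x)\le\delta_1$ for a.e. $x\in\mathbb{R}$ and: (i) if $\lim_{x\to s^+}F'(x)\lim_{x\to s^-}F'(x)=0$ for some $s\in\mathbb{R}$, then $s=x_0$; (ii) there exist $\delta_0,r_{x_0}>0$ with $0<\delta_0\le F'(x)\le\delta_1$ for a.e. $x\in\mathbb{R}\setminus\mathcal{B}(x_0,r_{x_0})$,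 where $\mathcal{B}(x_0,r_{x_0})$ is the ball of center $x_0$ and radius $r_{x_0}$; (iii) $F'$ is non-decreasing on $\overline{\mathcal{B}(x_0,r_{x_0})}$. Regularization. For such $F$ (with constants $\delta_0,\delta_1$) and $\gamma>0$, a regularization $F_\gamma:\mathbb{R}\to\mathbb{R}$ of $F$ satisfies $0<\gamma\delta_0\le F_\gamma'(x)\le\delta_1$ and $|F(x)-F_\gamma(x)|\le C\gamma^\sigma$ for all $x\in\mathbb{R}$, where $\sigma>0$ and $C>0$ do not depend on $\gamma$ or $x$. Existence of such regularizations of $\mathcal{R}$ is assumed. Assumptions. $(\mathrm{A}_1)$ $\mathbf{A}=(a_{ij}):Y\to\mathbb{R}^{d\times d}$ is essentially bounded, $Y$-periodic, symmetric, globally Lipschitz, and there are $\varepsilon$-independent $\underline\gamma,\overline\gamma>0$ with $\underline\gamma|\xi|^2\le\sum_{i,j}a_{ij}(x/\varepsilon)\xi_i\xi_j\le\overline\gamma|\xi|^2$ for all $\xi\in\mathbb{R}^d$. $(\mathrm{A}_2)$ $\mathcal{R}:\mathbb{R}\to\mathbb{R}$ is degenerate at some point, with constants $\delta_0,\delta_1$. $(\mathrm{A}_3)$ $f\in L^2(\Omega)$. Iteration. $u_\varepsilon^0=0$, and for $k\ge1$, $u_\varepsilon^k\in V^\varepsilon$ is the unique solution of $$\int_{\Omega^\varepsilon}\mathbf{A}(x/\varepsilon)\nabla u_\varepsilon^k\cdot\nabla\varphi\,dx+M\int_{\Omega^\varepsilon}u_\varepsilon^k\varphi\,dx=\int_{\Omega^\varepsilon}f\varphi\,dx+M\int_{\Omega^\varepsilon}u_\varepsilon^{k-1}\varphi\,dx-\varepsilon^\alpha\int_{\Omega^\varepsilon}\mathcal{R}_{\gamma_k}(u_\varepsilon^{k-1})\varphi\,dx\quad\text{for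 all }\varphi\in V^\varepsilon.$$ *)

(* Defs.v *)
From HB Require Import structures.
From mathcomp Require Import all_boot all_order all_algebra.
From mathcomp Require Import all_classical all_reals all_analysis.

Set Implicit Arguments.
Unset Strict Implicit.
Unset Printing Implicit Defensive.
Import Order.TTheory GRing.Theory Num.Theory.
Import numFieldNormedType.Exports.
Local Open Scope classical_set_scope.
Local Open Scope ring_scope.

(* R^n is the type 'rV[R]_n. Its library topology is that of the sup norm, hence
   the usual one; the sigma-algebra below, generated by the coordinates, is the
   Borel one. *)
Definition measure_rV_display : measure_display. Proof. exact. Qed.

Section measurable_rV.
Context {R : realType} (n : nat).

Definition coord_rV (i : 'I_n) (x : 'rV[R]_n) : R := x ord0 i.

Let rV_set0 : g_sigma_preimage coord_rV set0.
Proof. exact: sigma_algebra0. Qed.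

Let rV_setC A : g_sigma_preimage coord_rV A -> g_sigma_preimage coord_rV (~` A).
Proof. exact: sigma_algebraC. Qed.

Let rV_bigcup (F : _^nat) : (forall i, g_sigma_preimage coord_rV (F i)) ->
  g_sigma_preimage coord_rV (\bigcup_i (F i)).
Proof. exact: sigma_algebra_bigcup. Qed.

HB.instance Definition _ := @isMeasurable.Build measure_rV_display
  'rV[R]_n (g_sigma_preimage coord_rV) rV_set0 rV_setC rV_bigcup.

Lemma measurable_coord_rV i : measurable_fun [set: 'rV[R]_n] (coord_rV i).
Proof.
move=> _ Y mY; rewrite setTI; apply: sub_sigma_algebra => /=.
rewrite -bigcup_seq/=; exists i => /=; first by rewrite mem_index_enum.
by exists Y => //; rewrite setTI.
Qed.

Lemma measurable_fun_coord_rVP d (T : measurableType d) (f : T -> 'rV[R]_n) :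
  measurable_fun [set: T] f <->
  forall i, measurable_fun [set: T] (coord_rV i \o f).
Proof.
split=> [mf i|mf].
  by apply: measurableT_comp mf; exact: measurable_coord_rV.
have sub : g_sigma_preimage (fun i => coord_rV i \o f) `<=` measurable.
  apply: smallest_sub; first exact: sigma_algebra_measurable.
  rewrite -bigcup_seq => A [i _ [B mB <-]]; exact: mf.
rewrite g_sigma_preimage_comp in sub.
by move=> _ A mA; apply: sub; exists A.
Qed.

End measurable_rV.

Section lebesgue_measure_rV.
Context {R : realType}.
Local Open Scope ereal_scope.

Definition cons_rV n (p : R * 'rV[R]_n) : 'rV[R]_n.+1 :=
  row_mx (const_mx p.1 : 'rV_1) p.2.

Lemma cons_rV0 n (p : R * 'rV[R]_n) : cons_rV p ord0 ord0 = p.1.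
Proof.
rewrite /cons_rV (_ : ord0 = lshift n (ord0 : 'I_1)); last exact/val_inj.
by rewrite (row_mxEl (const_mx p.1 : 'rV_1) p.2) mxE.
Qed.

Lemma cons_rVS n (p : R * 'rV[R]_n) i :
  cons_rV p ord0 (lift ord0 i) = p.2 ord0 i.
Proof.
rewrite /cons_rV (_ : lift ord0 i = rshift 1 i); last exact/val_inj.
exact: (row_mxEr (const_mx p.1 : 'rV_1) p.2).
Qed.

Lemma measurable_cons_rV n : measurable_fun [set: R * 'rV[R]_n] (@cons_rV n).
Proof.
apply/measurable_fun_coord_rVP => i; have [j ->|->] := unliftP ord0 i.
- rewrite (_ : _ \o _ = coord_rV j \o snd).
    by apply: measurableT_comp => //; exact: measurable_coord_rV.
  by apply/funext => p; exact: cons_rVS.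
- rewrite (_ : _ \o _ = fst); last by apply/funext => p; exact: cons_rV0.
  exact: measurable_fst.
Qed.

Section step.
Context (n : nat) (m : {sigma_finite_measure set 'rV[R]_n -> \bar R}).

Definition lebesgue_rV_step : set 'rV[R]_n.+1 -> \bar R :=
  pushforward (@lebesgue_measure R \x m) (@cons_rV n).

Let step0 : lebesgue_rV_step set0 = 0.
Proof. by rewrite /lebesgue_rV_step /pushforward preimage_set0 measure0. Qed.

Let step_ge0 A : 0 <= lebesgue_rV_step A.
Proof. by apply: integral_ge0. Qed.

Let step_sigma_additive : semi_sigma_additive lebesgue_rV_step.
Proof.
have mcons A : measurable A -> measurable (@cons_rV n @^-1` A).
  by move=> mA; rewrite -[X in measurable X]setTI; exact: measurable_cons_rV.
move=> F mF tF mUF; rewrite /lebesgue_rV_step /pushforward preimage_bigcup.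
apply: measure_semi_sigma_additive => [i||]; first exact: mcons.
- by apply/trivIsetP => i j _ _ ij; rewrite -preimage_setI;
    move/trivIsetP : tF => /(_ _ _ _ _ ij) ->//; rewrite preimage_set0.
- by rewrite -preimage_bigcup; exact: mcons.
Qed.

HB.instance Definition _ := isMeasure.Build _ _ _ lebesgue_rV_step
  step0 step_ge0 step_sigma_additive.

Let step_sigma_finite : sigma_finite setT lebesgue_rV_step.
Proof.
have /sigma_finiteP[F [TF ndF mF]] := sigma_finiteT (@lebesgue_measure R).
have /sigma_finiteP[G [TG ndG mG]] := sigma_finiteT m.
pose uncons (x : 'rV[R]_n.+1) : R * 'rV[R]_n :=
  (x ord0 ord0, \row_i x ord0 (lift ord0 i)).
have consK : cancel (@cons_rV n) uncons.
  move=> [r y]; rewrite /uncons cons_rV0; congr (_, _).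
  by apply/rowP => i; rewrite mxE cons_rVS.
have muncons : measurable_fun setT uncons.
  apply/measurable_fun_pairP; split; first exact: (measurable_coord_rV ord0).
  apply/measurable_fun_coord_rVP => i.
  rewrite (_ : _ \o _ = coord_rV (lift ord0 i)); first exact: measurable_coord_rV.
  by apply/funext => x; rewrite /coord_rV/= mxE.
exists (fun k => uncons @^-1` (F k `*` G k)).
  apply/esym; rewrite -subTset => x _.
  have [i _ Fi] : (\bigcup_i F i) (uncons x).1 by rewrite -TF.
  have [j _ Gj] : (\bigcup_i G i) (uncons x).2 by rewrite -TG.
  exists (maxn i j) => //; split.
    by move: Fi; apply/subsetPset/ndF/leq_maxl.
  by move: Gj; apply/subsetPset/ndG/leq_maxr.
move=> k; have [mFk Fk] := mF k; have [mGk Gk] := mG k; split.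
  by rewrite -[X in measurable X]setTI; apply: muncons => //; exact: measurableX.
rewrite /lebesgue_rV_step /pushforward -comp_preimage.
rewrite (_ : _ \o _ = id); last by apply/funext => x; exact: consK.
by rewrite preimage_id product_measure1E// lte_mul_pinfty// ge0_fin_numE.
Qed.

HB.instance Definition _ := Measure_isSigmaFinite.Build _ _ _
  lebesgue_rV_step step_sigma_finite.

End step.

Fixpoint lebesgue_rV n : {sigma_finite_measure set 'rV[R]_n -> \bar R} :=
  if n is n'.+1 then lebesgue_rV_step (lebesgue_rV n')
  else @dirac _ 'rV[R]_0 (0%R : 'rV[R]_0) R.

(* The measure is determined by its values on boxes. *)
Lemma lebesgue_rV_box n (A : 'I_n -> set R) :
  (forall i, measurable (A i)) ->
  lebesgue_rV n [set x | forall i, A i (x ord0 i)] =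
  \prod_(i < n) lebesgue_measure (A i).
Proof.
elim: n A => [|n IH] A mA.
  rewrite big_ord0 /= diracE mem_set//= => -[]//.
rewrite big_ord_recl -IH// /lebesgue_rV -/lebesgue_rV /= /lebesgue_rV_step.
have mbox : measurable [set x : 'rV[R]_n | forall i, A (lift ord0 i) (x ord0 i)].
  rewrite (_ : [set _ | _] =
      \bigcap_(i in [set: 'I_n]) (coord_rV i @^-1` A (lift ord0 i))).
    apply: fin_bigcap_measurable => // i _.
    by rewrite -[X in measurable X]setTI; exact: measurable_coord_rV.
  by apply/seteqP; split => x /= h i; [move=> _|]; apply: h.
rewrite -product_measure1E//; last exact: mA.
rewrite /pushforward; congr product_measure1.
apply/seteqP; split => -[r x] /=.
  move=> h; split; first by have := h ord0; rewrite cons_rV0.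
  by move=> i; have := h (lift ord0 i); rewrite cons_rVS.
move=> [h0 h] i; have [j ->|->] := unliftP ord0 i; last first.
  by rewrite cons_rV0.
by rewrite cons_rVS; exact: h.
Qed.

End lebesgue_measure_rV.

Section euclidean.
Context {R : realType} {n : nat}.
Implicit Types (x y : 'rV[R]_n) (D U : set 'rV[R]_n).

Definition dot x y : R := \sum_i x ord0 i * y ord0 i.

(* The library norm `|x| on row vectors is the sup norm. *)
Definition enorm x : R := Num.sqrt (dot x x).

Definition boundary D : set 'rV[R]_n := closure D `\` D°.

(* Near each of its boundary points, D is the set of points lying strictly above
   (or on) the graph of a Lipschitz function over the hyperplane orthogonal to a
   unit vector e; y - dot y e *: e is the projection of y on that hyperplane.
   The clauses only involve the interior and the boundary, so that the notion
   applies to open sets as well as to closed ones. *)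
Definition lipschitz_boundary D : Prop :=
  forall x, boundary D x ->
  exists r e (g : 'rV[R]_n -> R),
    [/\ 0 < r, enorm e = 1, [lipschitz g y | y in setT] &
      forall y, enorm (y - x) < r ->
        (D° y <-> g (y - dot y e *: e) < dot y e) /\
        (boundary D y <-> dot y e = g (y - dot y e *: e))].

(* The intersection of the half-spaces dot h.1 x <= h.2. *)
Definition polyhedron (s : seq ('rV[R]_n * R)) : set 'rV[R]_n :=
  [set x | forall h, h \in s -> dot h.1 x <= h.2].

Definition polyhedral_domain D : Prop :=
  [/\ open D, connected D, D !=set0, bounded_set D &
    exists ps : seq (seq ('rV[R]_n * R)),
      D = (\bigcup_(s in [set` ps]) polyhedron s)°].

End euclidean.

Section sobolev.
Context {R : realType} {n : nat}.
Local Notation mu := (@lebesgue_rV R n).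
Implicit Types (D U : set 'rV[R]_n) (u phi : 'rV[R]_n -> R).
Implicit Types (G : 'rV[R]_n -> 'rV[R]_n).

(* Functions on D are represented by functions on R^n of which only the values
   on D matter; L^2 and its norm are those of the extension by 0. *)
Definition L2 D u : Prop := (u \_ D) \in Lfun mu 2%:E.

Definition normL2 D u : R := fine ('N[mu]_2%:E [EFin \o (u \_ D)])%E.

Definition vnormL2 D G : R := normL2 D (fun x => enorm (G x)).

Definition pderiv (i : 'I_n) phi : 'rV[R]_n -> R :=
  'D_(delta_mx ord0 i) phi.

Definition grad phi : 'rV[R]_n -> 'rV[R]_n := fun x => \row_i pderiv i phi x.

Definition smooth phi : Prop :=
  forall (s : seq 'I_n) x, differentiable (foldr pderiv phi s) x.

(* phi is in C_c^oo(U). *)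
Definition test_function U phi : Prop :=
  [/\ smooth phi, compact (closure [set x | phi x != 0]) &
    closure [set x | phi x != 0] `<=` U].

Definition weak_gradient D u G : Prop :=
  forall phi, test_function D phi -> forall i,
    \int[mu]_(x in D) (u x * pderiv i phi x) =
    - \int[mu]_(x in D) (G x ord0 i * phi x).

(* An element of H^1(D) is given together with (a representative of) its
   gradient, which is unique up to a null set. *)
Definition H1 D u G : Prop :=
  [/\ L2 D u, forall i, L2 D (fun x => G x ord0 i) & weak_gradient D u G].

(* u = 0 on the part Gamma of the boundary of D in the sense of H^1: u is the
   limit in H^1(D) of smooth functions vanishing near Gamma. *)
Definition H1_zero_on (Gamma : set 'rV[R]_n) D u G : Prop :=
  H1 D u G /\
  exists phi : nat -> 'rV[R]_n -> R,
    [/\ forall m, test_function (~` Gamma) (phi m),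
        normL2 D (fun x => u x - phi m x) @[m --> \oo] --> (0 : R) &
        vnormL2 D (fun x => G x - grad (phi m) x) @[m --> \oo] --> (0 : R)].

End sobolev.

Section perforated.
Context {R : realType} {d : nat}.
Implicit Types (Omega hole S : set 'rV[R]_d) (I : set 'rV[int]_d) (eps : R).

Definition cell : set 'rV[R]_d := [set x | forall i, 0 <= x ord0 i <= 1].

(* The pore part of the cell is cell `\` hole. *)
Definition is_hole hole : Prop :=
  [/\ hole `<=` cell, hole !=set0, closed hole & lipschitz_boundary hole].

Definition lattice (z : 'rV[int]_d) : 'rV[R]_d := map_mx intr z.

Definition copy eps (z : 'rV[int]_d) S : set 'rV[R]_d :=
  [set eps *: (lattice z + y) | y in S].

Definition perforated Omega hole eps I : set 'rV[R]_d :=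
  Omega `\` \bigcup_(z in I) copy eps z hole.

Definition holes_boundary hole eps I : set 'rV[R]_d :=
  \bigcup_(z in I) boundary (copy eps z hole).

(* I is the set of the positions of the removed holes. Every scaled cell inside
   Omega is perforated; whether the other holes contained in Omega are removed
   as well is left open. *)
Definition perforation Omega hole eps I : Prop :=
  [/\ forall z, copy eps z cell `<=` Omega -> I z,
      forall z, I z -> copy eps z hole `<=` Omega &
    let Oe := perforated Omega hole eps I in
    [/\ bounded_set Oe, connected Oe, lipschitz_boundary Oe &
        boundary Oe = holes_boundary hole eps I `|` boundary Omega]].

(* A is the periodic extension to R^d of a matrix field on the cell. *)
Definition coefficients (A : 'rV[R]_d -> 'M[R]_d) (glo gup : R) : Prop :=
  [/\ exists K, {ae lebesgue_rV d, forall y, forall i j, `|A y i j| <= K},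
      forall y z, A (y + lattice z) = A y,
      forall y, (A y)^T = A y,
      [lipschitz A y | y in setT] &
    [/\ 0 < glo, 0 < gup &
      forall eps x (xi : 'rV[R]_d), 0 < eps < 1 ->
        glo * enorm xi ^+ 2
          <= \sum_i \sum_j A (eps^-1 *: x) i j * xi ord0 i * xi ord0 j
          <= gup * enorm xi ^+ 2]].

End perforated.

Section degenerate.
Context {R : realType}.
Implicit Types (F : R -> R).

(* F' is only defined almost everywhere: its one-sided limits and its
   monotonicity are taken along the points where F is derivable. *)
Definition degenerate_at F (x0 d0 d1 : R) : Prop :=
  let diff := [set x | derivable F x 1] in
  [/\ 0 < d0, 0 < d1,
      {ae lebesgue_measure, forall x, diff x /\ 0 <= derive1 F x <= d1},
      forall s l r : R,
        derive1 F x @[x --> within diff s^'+] --> r ->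
        derive1 F x @[x --> within diff s^'-] --> l ->
        r * l = 0 -> s = x0 &
    exists r0 : R, [/\ 0 < r0,
      {ae lebesgue_measure, forall x, ~ ball x0 r0 x ->
        diff x /\ d0 <= derive1 F x <= d1} &
      forall x y, diff x -> diff y -> closed_ball x0 r0 x ->
        closed_ball x0 r0 y -> x <= y -> derive1 F x <= derive1 F y]].

Definition regularization F (d0 d1 C sigma gamma : R) (Fg : R -> R) : Prop :=
  forall x, [/\ derivable Fg x 1, 0 < gamma * d0,
    gamma * d0 <= derive1 Fg x <= d1 & `|F x - Fg x| <= C * gamma `^ sigma].

End degenerate.

Section iteration.
Context {R : realType} {d : nat}.
Local Notation mu := (@lebesgue_rV R d).
Variables (D : set 'rV[R]_d).
Variable V : ('rV[R]_d -> R) -> ('rV[R]_d -> 'rV[R]_d) -> Prop.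

(* u k is the k-th iterate and Du k its gradient; B is the diffusion matrix
   x |-> A (x / eps), c is eps ^ alpha and Rk k is the regularization used at
   step k. *)
Definition iterates (B : 'rV[R]_d -> 'M[R]_d) (f : 'rV[R]_d -> R) (M c : R)
    (Rk : nat -> R -> R) (u : nat -> 'rV[R]_d -> R)
    (Du : nat -> 'rV[R]_d -> 'rV[R]_d) : Prop :=
  u 0%N = (fun=> 0) /\
  forall k, (1 <= k)%N -> V (u k) (Du k) /\
    forall phi Dphi, V phi Dphi ->
      \int[mu]_(x in D) dot (Du k x *m (B x)^T) (Dphi x)
        + M * \int[mu]_(x in D) (u k x * phi x) =
      \int[mu]_(x in D) (f x * phi x)
        + M * \int[mu]_(x in D) (u k.-1 x * phi x)
        - c * \int[mu]_(x in D) (Rk k (u k.-1 x) * phi x).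

End iteration.

(* Main.v *)
(** Put v_k = u_k - u_{k-1} and c = eps^alpha.  Subtracting the equations of two
    consecutive steps and testing with v_k leaves on the right-hand side
      ((M - c t) v_{k-1} + c (R_{k-1} - R_k)(u_{k-2})) v_k,
    where t, the slope of R_k between u_{k-2} and u_{k-1}, lies in
    [gamma_k delta0, delta1].  The gap g = c gamma_k delta0 between M and
    M - c t <= M - g is exactly what is needed to absorb the regularization error
    by Young's inequality (pointwise, with weights M - c t and g), at the price of
    a source term of order gamma_{k-1}^(2 sigma) / gamma_k, while keeping the
    coefficient M/2 in front of v_{k-1}^2.  Poincare's inequality then turns the
    estimate into a contraction of factor q, which is iterated.  The source term
    f cancels in the subtraction. *)

Require Import Defs.
From mathcomp Require Import all_boot all_order all_algebra.
From mathcomp Require Import all_classical all_reals all_analysis.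
From mathcomp Require Import measurable_realfun ring lra.
Set Implicit Arguments.
Unset Strict Implicit.
Unset Printing Implicit Defensive.
Import Order.TTheory GRing.Theory Num.Theory.
Import numFieldNormedType.Exports.
Local Open Scope classical_set_scope.
Local Open Scope ring_scope.

(** * Borel sets of R^n *)

Lemma measurable_box (R : realType) n (a : 'I_n -> set R) :
  (forall i, measurable (a i)) ->
  measurable [set x : 'rV[R]_n | forall i, a i (x ord0 i)].
Proof.
move=> ma; rewrite (_ : [set _ | _] =
    \bigcap_(i in [set: 'I_n]) (coord_rV i @^-1` a i)).
  apply: fin_bigcap_measurable => // i _.
  by rewrite -[X in measurable X]setTI; exact: measurable_coord_rV.
by apply/seteqP; split => x /= h i; [move=> _|]; apply: h.
Qed.

Lemma open_measurable_rV (R : realType) n (U : set 'rV[R]_n) :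
  open U -> measurable U.
Proof.
move=> oU.
(* U is the union of the boxes of the grids of mesh 1 / (m + 1) that it contains. *)
pose box (p : nat * 'rV[int]_n) := [set x : 'rV[R]_n | forall i,
  `[(p.2 ord0 i)%:~R / p.1.+1%:R, ((p.2 ord0 i) + 1)%:~R / p.1.+1%:R[%classic
    (x ord0 i)].
have -> : U = \bigcup_p (if pselect (box p `<=` U) then box p else set0).
  apply/seteqP; split=> x; last by move=> [p _]; case: pselect => // s /s.
  move=> Ux; have /nbhs_ballP[e /= e0 eU] : nbhs x U by exact: open_nbhs_nbhs.
  (* With m the integer part of 1/e, the mesh 1/(m+1) is smaller than e, so the grid box containing
     x stays in the ball of radius e around x. *)
  pose m := `|Num.floor e^-1|%N.
  have me : m.+1%:R^-1 < e.
    rewrite -[ltRHS]invrK ltf_pV2 ?posrE ?invr_gt0//.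
    have := lt_succ_floor e^-1.
    rewrite /m -natr1 natr_absz ger0_norm ?intrD//.
    by rewrite Num.Theory.floor_ge0 invr_ge0 ltW.
  pose z : 'rV[int]_n := \row_i Num.floor (x ord0 i * m.+1%:R).
  have bx : box (m, z) x.
    move=> i /=; rewrite in_itv/= mxE ler_pdivrMr// ltr_pdivlMr//.
    by rewrite ge_floor/= lt_succ_floor.
  exists (m, z) => //; case: pselect => // bU; exfalso; apply: bU.
  move=> y by_; apply: eU; split => // i j; rewrite ord1 /ball/=.
  have := bx j; have := by_ j; rewrite /= !in_itv/= intrD mulrDl mul1r.
  move=> /andP[a1 a2] /andP[a3 a4].
  change (`|x ord0 j - y ord0 j| < e).
  move: (_ / _) (x ord0 j) (y ord0 j) a1 a2 a3 a4 => c s t a1 a2 a3 a4.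
  by rewrite ltr_norml; apply/andP; split; move: (_^-1) me a2 a4 => w; lra.
apply: countable_bigcupT_measurable => [|p]; first exact: countableP.
case: pselect => //= ?.
apply: (@measurable_box _ _ (fun i => `[_, _[%classic)) => i.
exact: measurable_itv.
Qed.

Lemma closed_measurable_rV (R : realType) n (U : set 'rV[R]_n) :
  closed U -> measurable U.
Proof.
move=> cU; rewrite -(setCK U); apply: measurableC; apply: open_measurable_rV.
exact: closed_openC.
Qed.

Lemma continuous_measurable_rV (R : realType) n (g : 'rV[R]_n -> R) :
  continuous g -> measurable_fun setT g.
Proof.
move=> cg; apply: (measurability _ (RGenOpens.measurableE R)) => _ [_ [a [b ->] <-]].
rewrite setTI; apply: open_measurable_rV; apply: open_comp; last exact: interval_open.
by move=> x _; exact: cg.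
Qed.

(** * Square-integrable functions *)

Section L2_theory.
Context (R : realType) (n : nat) (D : set 'rV[R]_n).
Context (mD : measurable D).
Local Notation mu := (@lebesgue_rV R n).
Implicit Types u v : 'rV[R]_n -> R.

(** Squaring commutes with extension by 0, so everything after this lemma can be done with integrals
    over [D] instead of integrals of extensions to the whole space. *)
Lemma L2P u : L2 D u <->
  measurable_fun D u /\ mu.-integrable D (EFin \o (fun x => u x ^+ 2)).
Proof.
have E : (EFin \o (fun x => (u \_ D) x ^+ 2)) =
    (EFin \o (fun x => u x ^+ 2)) \_ D.
  apply/funext => x /=; rewrite !patchE; case: ifP => //=.
  by rewrite expr0n.
split.
- move=> L; move: (L) => /andP[]; rewrite inE/= => mu_ _; split.
    exact/(measurable_restrictT _ mD).
  by apply/integrable_mkcond => //; rewrite -E; exact: Lfun2_integrable_sqr.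
- move=> [mu_ /(integrable_mkcond _ mD)]; rewrite -E => /integrableP[_ iu].
  apply/andP; split; rewrite inE/=; first exact/(measurable_restrictT _ mD).
  rewrite /finite_norm unlock poweR_lty//; apply: le_lt_trans iu.
  rewrite le_eqVlt; apply/orP; left; apply/eqP; apply: eq_integral => x _ /=.
  by rewrite powR_mulrn// normrX.
Qed.

(** The identity needs no integrability: when the integral is infinite, [fine] makes both sides
    0. *)
Lemma normL2_sqr u : normL2 D u ^+ 2 = \int[mu]_(x in D) (u x ^+ 2).
Proof.
rewrite /normL2 unlock fine_poweR -powR_mulrn ?powR_ge0// -powRrM mulVf//.
rewrite powRr1; last by apply: fine_ge0; apply: integral_ge0 => x _; rewrite poweR_ge0.
rewrite Rintegral_mkcond /Rintegral; congr fine; apply: eq_integral => x _ /=.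
rewrite powR_mulrn// real_normK ?num_real//.
by rewrite !patchE; case: ifP => //; rewrite expr0n.
Qed.

Lemma normL2_ge0 u : 0 <= normL2 D u.
Proof. by apply: fine_ge0; exact: Lnorm_ge0. Qed.

Lemma vnormL2_sqr (G : 'rV[R]_n -> 'rV[R]_n) :
  vnormL2 D G ^+ 2 = \int[mu]_(x in D) dot (G x) (G x).
Proof.
rewrite /vnormL2 normL2_sqr; apply: eq_Rintegral => x _.
by rewrite sqr_sqrtr// sumr_ge0// => i _; rewrite -expr2 sqr_ge0.
Qed.

Lemma L2_mono u (g : 'rV[R]_n -> R) : measurable_fun D u ->
  mu.-integrable D (EFin \o g) -> (forall x, D x -> u x ^+ 2 <= g x) -> L2 D u.
Proof.
move=> mu_ ig ug; apply/L2P; split=> //.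
apply: le_integrable ig => //.
  by apply/measurable_EFinP; exact: measurable_funX.
move=> x Dx /=; rewrite lee_fin !ger0_norm ?ug ?sqr_ge0//.
by rewrite (le_trans _ (ug _ Dx))// sqr_ge0.
Qed.

Lemma L2_measurable {u} : L2 D u -> measurable_fun D u.
Proof. by move/L2P => []. Qed.

Lemma L2_integrable_sqr {u} : L2 D u ->
  mu.-integrable D (EFin \o (fun x => u x ^+ 2)).
Proof. by move/L2P => []. Qed.

(** Here and in [integrableZr] the operation stays inside [EFin], so that dominating functions can
    be assembled as nested terms. *)
Lemma integrableDr {f g : 'rV[R]_n -> R} : mu.-integrable D (EFin \o f) ->
  mu.-integrable D (EFin \o g) ->
  mu.-integrable D (EFin \o (fun x => f x + g x)).
Proof. by move=> fi gi; have := integrableD mD fi gi. Qed.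

Lemma integrableZr {f : 'rV[R]_n -> R} (c : R) : mu.-integrable D (EFin \o f) ->
  mu.-integrable D (EFin \o (fun x => c * f x)).
Proof. by move=> fi; have := integrableZl mD c fi. Qed.

Lemma L2_integrableM {u v} : L2 D u -> L2 D v ->
  mu.-integrable D (EFin \o (fun x => u x * v x)).
Proof.
move=> uL vL.
have i2 := integrableDr (L2_integrable_sqr uL) (L2_integrable_sqr vL).
apply: le_integrable i2 => //.
  by apply/measurable_EFinP; apply: measurable_funM; exact: L2_measurable.
move=> x _ /=; rewrite lee_fin [leRHS]ger0_norm ?addr_ge0 ?sqr_ge0//.
(* The squares of a + b and a - b being nonnegative, |ab| is at most a^2 + b^2. *)
move: (u x) (v x) => a b; rewrite ler_norml.
have := sqr_ge0 (a - b); have := sqr_ge0 (a + b).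
have := sqr_ge0 a; have := sqr_ge0 b.
by move=> ? ? ? ?; apply/andP; split; lra.
Qed.

Lemma L2B {u v} : L2 D u -> L2 D v -> L2 D (fun x => u x - v x).
Proof.
move=> uL vL.
have i2 := integrableZr 2
  (integrableDr (L2_integrable_sqr uL) (L2_integrable_sqr vL)).
apply: L2_mono i2 _; first by apply: measurable_funB; exact: L2_measurable.
by move=> x _; have := sqr_ge0 (u x + v x) => ?; lra.
Qed.

Lemma L2Z {u} (c : R) : L2 D u -> L2 D (fun x => c * u x).
Proof.
move=> uL; apply: L2_mono (integrableZr (c ^+ 2) (L2_integrable_sqr uL)) _.
  by apply: measurable_funM => //; exact: L2_measurable.
by move=> x _; rewrite exprMn.
Qed.

(** * Bounded sets: finite measure, and continuous functions are square-integrable *)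

Section bounded.
Context (bD : bounded_set D).

Lemma bounded_box : exists2 r : R, 0 < r & forall x, D x -> forall i, `|x ord0 i| <= r.
Proof.
have [M [_ MD]] := bD.
(* [bounded_set] gives a bound for each real strictly above some M of unknown sign; [|M| + 1] is
   such a real and is positive. *)
exists (`|M| + 1) => [|x Dx i]; first by rewrite ltr_wpDl.
have := MD (`|M| + 1); rewrite ltr_pwDr ?ler_norm// => /(_ isT x Dx).
apply: le_trans; rewrite /Num.norm/= mx_normrE.
by apply: (le_bigmax _ (fun ij : 'I_1 * 'I_n => `|x ij.1 ij.2|) (ord0, i)).
Qed.

Lemma mu_bounded : (mu D < +oo)%E.
Proof.
have [r r0 rD] := bounded_box.
pose B := [set x : 'rV[R]_n | forall i, `[- r, r]%classic (x ord0 i)].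
have mB : measurable B.
  by apply: (@measurable_box _ _ (fun=> `[- r, r]%classic)) => i; exact: measurable_itv.
apply: (@le_lt_trans _ _ (mu B)).
  apply: le_measure; rewrite ?inE// => x Dx i /=.
  by rewrite in_itv/= -ler_norml rD.
rewrite (lebesgue_rV_box (fun _ : 'I_n => measurable_itv `[- r, r])).
rewrite ltey_eq prode_fin_num// => i _.
by rewrite lebesgue_measure_itv/=; case: ifP.
Qed.

Lemma L2_continuous u : continuous u -> L2 D u.
Proof.
move=> cu.
have [r _ rD] := bounded_box.
pose B := [set x : 'rV[R]_n | forall i, `[- r, r]%classic (x ord0 i)].
(* [D] itself may fail to be closed, so u is bounded on a compact box containing it. *)
have cB : compact B.
  by apply: (@rV_compact R n (fun=> `[- r, r]%classic)) => i; exact: segment_compact.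
have /compact_bounded[M [_ Mu]] : compact (u @` B).
  by apply: continuous_compact => //; exact: continuous_subspaceT.
apply: (@L2_mono _ (fun=> (`|M| + 1) ^+ 2)).
- by apply: measurable_funTS; exact: continuous_measurable_rV.
- apply: measurable_bounded_integrable => //; first exact: mu_bounded.
  exact: bounded_cst.
- move=> x Dx; rewrite -[leLHS]real_normK ?num_real//.
  rewrite lerXn2r ?nnegrE ?addr_ge0//.
  apply: Mu; first by rewrite ltr_pwDr// ler_norm.
  by exists x => // i /=; rewrite in_itv/= -ler_norml rD.
Qed.

End bounded.

End L2_theory.

(** * Linearity of H^1 with zero trace *)

Section sobolev_sub.
Context (R : realType) (n : nat).
Local Notation mu := (@lebesgue_rV R n).
Implicit Types (u v phi psi : 'rV[R]_n -> R) (G H : 'rV[R]_n -> 'rV[R]_n).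

Lemma smooth_continuous phi (s : seq 'I_n) :
  smooth phi -> continuous (foldr pderiv phi s).
Proof. by move=> sphi x; apply: differentiable_continuous; exact: sphi. Qed.

(** Smoothness quantifies over lists of directions, so linearity is proved by induction on the list;
    gradients are the case of singletons. *)
Lemma foldr_pderivB phi psi (s : seq 'I_n) : smooth phi -> smooth psi ->
  foldr pderiv (fun x => phi x - psi x) s =
  (fun x => foldr pderiv phi s x - foldr pderiv psi s x).
Proof.
move=> sphi spsi; elim: s => [//|i s IH] /=; rewrite IH; apply/funext => x.
by rewrite /pderiv -deriveB//; apply: diff_derivable; [exact: sphi|exact: spsi].
Qed.

Lemma gradB phi psi x : smooth phi -> smooth psi ->
  grad (fun x => phi x - psi x) x = grad phi x - grad psi x.
Proof.
move=> sphi spsi; apply/rowP => i; rewrite !mxE.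
by have /= -> := @foldr_pderivB _ _ [:: i] sphi spsi.
Qed.

Lemma smoothB phi psi : smooth phi -> smooth psi ->
  smooth (fun x => phi x - psi x).
Proof.
move=> sphi spsi s x; rewrite foldr_pderivB//.
by apply: differentiableB; [exact: sphi|exact: spsi].
Qed.

Lemma test_functionB (U : set 'rV[R]_n) phi psi : test_function U phi ->
  test_function U psi -> test_function U (fun x => phi x - psi x).
Proof.
move=> [sphi cphi phiU] [spsi cpsi psiU].
have sub : closure [set x | phi x - psi x != 0] `<=`
    closure [set x | phi x != 0] `|` closure [set x | psi x != 0].
  rewrite -closureU; apply: closure_subset => x /= xN0.
  have [p0|] := eqVneq (phi x) 0; last by left.
  by right; apply: contra_neq xN0 => ->; rewrite p0 subr0.
split; first exact: smoothB.
- apply: subclosed_compact sub; first exact: closed_closure.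
  exact: compactU.
- by apply: subset_trans sub _ => x [/phiU|/psiU].
Qed.

Context (D : set 'rV[R]_n).
Context (mD : measurable D) (bD : bounded_set D).

Lemma weak_gradientB u v G H : H1 D u G -> H1 D v H ->
  weak_gradient D (fun x => u x - v x) (fun x => G x - H x).
Proof.
move=> [uL GL wu] [vL HL wv] phi tphi i; have [sphi _ _] := tphi.
have cphi := @smooth_continuous _ [::] sphi.
have cdphi := @smooth_continuous _ [:: i] sphi.
have phiL := L2_continuous mD bD cphi.
have dphiL := L2_continuous mD bD cdphi.
transitivity (\int[mu]_(x in D) (u x * pderiv i phi x - v x * pderiv i phi x)).
  by apply: eq_Rintegral => x _; rewrite mulrBl.
rewrite RintegralB//; [|exact: L2_integrableM..].
rewrite wu// wv// opprK addrC -opprB; congr (- _).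
rewrite -RintegralB//;
  [|exact: (L2_integrableM mD (GL i) phiL)|exact: (L2_integrableM mD (HL i) phiL)].
by apply: eq_Rintegral => x _; rewrite !mxE mulrBl.
Qed.

Lemma H1B u v G H : H1 D u G -> H1 D v H ->
  H1 D (fun x => u x - v x) (fun x => G x - H x).
Proof.
move=> uH vH; have [uL GL _] := uH; have [vL HL _] := vH.
split; [exact: L2B|move=> i|exact: weak_gradientB].
rewrite (_ : (fun x => _) = fun x => G x ord0 i - H x ord0 i); first exact: L2B.
by apply/funext => x; rewrite !mxE.
Qed.

Lemma integrable_dot G H : (forall i, L2 D (fun x => G x ord0 i)) ->
  (forall i, L2 D (fun x => H x ord0 i)) ->
  mu.-integrable D (EFin \o (fun x => dot (G x) (H x))).
Proof.
move=> GL HL; rewrite (_ : _ \o _ =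
    fun x => (\sum_(i < n) (G x ord0 i * H x ord0 i)%:E)%E).
  by apply: integrable_sum => // i _; exact: (L2_integrableM mD (GL i) (HL i)).
by apply/funext => x /=; rewrite sumEFin.
Qed.

(** A triangle inequality with a spare factor 2, obtained from |a - b|^2 <= 2(|a|^2 + |b|^2) without
    Minkowski's inequality. The factor is harmless: this bound and the next one only serve to show
    that errors tend to 0. *)
Lemma vL2_le_normB G H : (forall i, L2 D (fun x => G x ord0 i)) ->
  (forall i, L2 D (fun x => H x ord0 i)) ->
  vnormL2 D (fun x => G x - H x) <= 2 * (vnormL2 D G + vnormL2 D H).
Proof.
move=> GL HL.
have ge0 K : 0 <= vnormL2 D K by exact: normL2_ge0.
rewrite -(ler_pXn2r (ltn0Sn 1)) ?nnegrE ?mulr_ge0 ?addr_ge0//.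
have : vnormL2 D (fun x => G x - H x) ^+ 2 <=
    2 * (vnormL2 D G ^+ 2 + vnormL2 D H ^+ 2).
  have GHL i : L2 D (fun x => (G x - H x) ord0 i).
    rewrite (_ : (fun x => _) = fun x => G x ord0 i - H x ord0 i).
      exact: L2B.
    by apply/funext => x; rewrite !mxE.
  have iG := integrable_dot GL GL; have iH := integrable_dot HL HL.
  rewrite !vnormL2_sqr -RintegralD// -RintegralZl//; last exact: integrableDr.
  apply: le_Rintegral => //; first exact: integrable_dot.
    by apply: integrableZr => //; exact: integrableDr.
  move=> x _; rewrite /dot -big_split mulr_sumr; apply: ler_sum => i _ /=.
  by rewrite !mxE; have := sqr_ge0 (G x ord0 i + H x ord0 i) => ?; lra.
have := mulr_ge0 (ge0 G) (ge0 H) => ? ?.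
have := sqr_ge0 (vnormL2 D G); have := sqr_ge0 (vnormL2 D H); lra.
Qed.

Lemma normL2_le_normB u v : L2 D u -> L2 D v ->
  normL2 D (fun x => u x - v x) <= 2 * (normL2 D u + normL2 D v).
Proof.
move=> uL vL.
rewrite -(ler_pXn2r (ltn0Sn 1)) ?nnegrE ?mulr_ge0 ?addr_ge0 ?normL2_ge0//.
have : normL2 D (fun x => u x - v x) ^+ 2 <=
    2 * (normL2 D u ^+ 2 + normL2 D v ^+ 2).
  have iu := L2_integrable_sqr mD uL; have iv := L2_integrable_sqr mD vL.
  rewrite !normL2_sqr -RintegralD// -RintegralZl//; last exact: integrableDr.
  apply: le_Rintegral => //; first by apply: L2_integrable_sqr => //; exact: L2B.
    by apply: integrableZr => //; exact: integrableDr.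
  by move=> x _ /=; have := sqr_ge0 (u x + v x) => ?; lra.
have := mulr_ge0 (normL2_ge0 D u) (normL2_ge0 D v) => ? ?.
have := sqr_ge0 (normL2 D u); have := sqr_ge0 (normL2 D v); lra.
Qed.

(** This makes the difference of two iterates an admissible test function and puts it within reach
    of Poincare's inequality. The differences of the two approximating sequences approximate the
    difference. *)
Lemma H1_zero_onB (Gamma : set 'rV[R]_n) u v G H :
  H1_zero_on Gamma D u G -> H1_zero_on Gamma D v H ->
  H1_zero_on Gamma D (fun x => u x - v x) (fun x => G x - H x).
Proof.
move=> [uH [phi [tphi uphi Gphi]]] [vH [psi [tpsi vpsi Hpsi]]].
split; first exact: H1B.
have [uL GL _] := uH; have [vL HL _] := vH.
have sphi m : smooth (phi m) by have [] := tphi m.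
have spsi m : smooth (psi m) by have [] := tpsi m.
have tL (chi : 'rV[R]_n -> R) : smooth chi -> L2 D chi.
  by move=> /(@smooth_continuous _ [::]); exact: L2_continuous.
have gL (chi : 'rV[R]_n -> R) i : smooth chi -> L2 D (fun x => grad chi x ord0 i).
  move=> /(@smooth_continuous _ [:: i])/(L2_continuous mD bD) /=.
  by congr (L2 D _); apply/funext => x; rewrite mxE.
have lim0 (a b : nat -> R) : a m @[m --> \oo] --> (0 : R) ->
    b m @[m --> \oo] --> (0 : R) -> 2 * (a m + b m) @[m --> \oo] --> (0 : R).
  move=> ca cb; have := cvgM (cvg_cst (2 : R)) (cvgD ca cb).
  by rewrite addr0 mulr0 => cab; exact: cab.
exists (fun m x => phi m x - psi m x); split.
- by move=> m; exact: test_functionB.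
- apply: (@squeeze_cvgr _ _ _ _ (fun=> 0)); [|exact: cvg_cst|exact: lim0 uphi vpsi].
  apply: nearW => m; rewrite normL2_ge0/=.
  rewrite (_ : (fun x => _) = fun x => (u x - phi m x) - (v x - psi m x)).
    by apply: normL2_le_normB; apply: L2B => //; exact: tL.
  by apply/funext => x; lra.
- apply: (@squeeze_cvgr _ _ _ _ (fun=> 0)); [|exact: cvg_cst|exact: lim0 Gphi Hpsi].
  apply: nearW => m; rewrite normL2_ge0/=.
  rewrite (_ : (fun x => _) = fun x => (G x - grad (phi m) x) - (H x - grad (psi m) x)).
    apply: vL2_le_normB => i.
      rewrite (_ : (fun x => _) = fun x => G x ord0 i - grad (phi m) x ord0 i).
        by apply: L2B => //; exact: gL.
      by apply/funext => x; rewrite !mxE.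
    rewrite (_ : (fun x => _) = fun x => H x ord0 i - grad (psi m) x ord0 i).
      by apply: L2B => //; exact: gL.
    by apply/funext => x; rewrite !mxE.
  by apply/funext => x; rewrite gradB//; apply/rowP => i; rewrite !mxE; lra.
Qed.

End sobolev_sub.

(** * Energy estimate *)

(** By the mean value theorem the slope is a value of the derivative of [Fg] and inherits its
    bounds. Exchanging x and y changes the sign of both differences, so their order is
    immaterial. *)
Lemma regularization_slope (R : realType) (F : R -> R) (d0 d1 C sigma g : R)
    (Fg : R -> R) (x y : R) : regularization F d0 d1 C sigma g Fg ->
  exists2 t, g * d0 <= t <= d1 & Fg x - Fg y = t * (x - y).
Proof.
move=> hF; wlog yx : x y / y <= x.
  move=> H; have [/H//|/ltW/H[t ht E]] := leP y x.
  by exists t => //; rewrite -opprB E -mulrN opprB.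
have dF (z : R) : is_derive z (1 : R) Fg (derive1 Fg z).
  by rewrite derive1E; apply: derivableP; have [] := hF z.
have cF : {within `[y, x], continuous Fg}.
  apply: continuous_subspaceT => z; apply: differentiable_continuous.
  by apply/derivable1_diffP; have [] := hF z.
have [z _ E] := MVT_segment yx (fun z _ => dF z) cF.
by exists (derive1 Fg z) => //; have [] := hF z.
Qed.

Lemma regularization_continuous (R : realType) (F : R -> R)
    (d0 d1 C sigma g : R) (Fg : R -> R) :
  regularization F d0 d1 C sigma g Fg -> continuous Fg.
Proof.
move=> hF z; apply: differentiable_continuous.
by apply/derivable1_diffP; have [] := hF z.
Qed.

(** Young's inequality is applied to p a v with equal weights and to Y v with weight g. The
    coefficients of v^2 add up to (p + g)/2 <= M/2, and that of a^2 is p/2 <= M/2. *)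
Lemma young_split (R : realType) (M g p a Y v h : R) :
  0 <= p -> 0 < g -> p + g <= M -> `|Y| <= h ->
  (p * a + Y) * v <= M / 2 * v ^+ 2 + M / 2 * a ^+ 2 + h ^+ 2 / (2 * g).
Proof.
move=> p0 g0 pgM Yh.
have h2 : Y ^+ 2 <= h ^+ 2.
  by rewrite -[leLHS]real_normK ?num_real// lerXn2r// nnegrE (le_trans _ Yh).
have : Y * v <= g / 2 * v ^+ 2 + h ^+ 2 / (2 * g).
  apply: (@le_trans _ _ (g / 2 * v ^+ 2 + Y ^+ 2 / (2 * g))); last first.
    by rewrite lerD2l ler_wpM2r// invr_ge0 mulr_ge0// ltW.
  (* The difference of the two sides is a completed square. *)
  rewrite -subr_ge0 (_ : _ - _ = g / 2 * (v - Y / g) ^+ 2).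
    by rewrite mulr_ge0 ?sqr_ge0// divr_ge0// ltW.
  by field; rewrite gt_eqF.
have := mulr_ge0 p0 (sqr_ge0 (a - v)).
have : (p + g) * v ^+ 2 <= M * v ^+ 2 by rewrite ler_wpM2r ?sqr_ge0.
have : p * a ^+ 2 <= M * a ^+ 2 by rewrite ler_wpM2r ?sqr_ge0//; lra.
move: (h ^+ 2 / (2 * g)) => K; lra.
Qed.

(** * Bilinear forms of symmetric matrices *)

Section dot_lemmas.
Context (R : realType) (n : nat).
Implicit Types (x y z : 'rV[R]_n) (B : 'M[R]_n).

Lemma dotE x y : dot x y = (x *m y^T) ord0 ord0.
Proof. by rewrite mxE; apply: eq_bigr => i _; rewrite mxE. Qed.

Lemma dotDl x y z : dot (x + y) z = dot x z + dot y z.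
Proof. by rewrite !dotE mulmxDl mxE. Qed.

Lemma dotNl x z : dot (- x) z = - dot x z.
Proof. by rewrite !dotE mulNmx mxE. Qed.

Lemma dotC x y : dot x y = dot y x.
Proof. by apply: eq_bigr => i _; rewrite mulrC. Qed.

Lemma dot_ge0 x : 0 <= dot x x.
Proof. by apply: sumr_ge0 => i _; rewrite -expr2 sqr_ge0. Qed.

Lemma dot_mulmx_sym B x y : B^T = B -> dot (x *m B^T) y = dot (y *m B^T) x.
Proof.
by move=> sB; rewrite dotC !dotE trmx_mul trmxK mulmxA sB.
Qed.

Lemma quad_formE B x : dot (x *m B^T) x =
  \sum_i \sum_j B i j * x ord0 i * x ord0 j.
Proof.
rewrite /dot; apply: eq_bigr => i _; rewrite mxE mulr_suml.
by apply: eq_bigr => j _; rewrite mxE; ring.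
Qed.

Lemma dot_mulmx_bound B (K : R) x y : B^T = B ->
  (forall z, 0 <= dot (z *m B^T) z <= K * dot z z) ->
  `|dot (x *m B^T) y| <= K / 2 * (dot x x + dot y y).
Proof.
move=> sB hB.
(* Polarization: 4 dot (x *m B^T) y is the form at x + y minus the form at x - y. *)
have /andP[p0 p1] := hB (x + y); have /andP[m0 m1] := hB (x - y).
move: p0 p1 m0 m1.
rewrite !mulmxDl !dotDl ![dot _ (x + y)]dotC ![dot _ (x - y)]dotC !dotDl.
rewrite !mulNmx !dotNl ![dot _ (- _)]dotC !dotNl.
rewrite ![dot _ (_ *m _)]dotC.
rewrite (dot_mulmx_sym y x sB) (dotC y x).
move=> *; rewrite ler_norml; apply/andP; split; lra.
Qed.

End dot_lemmas.

(** * Regularity of the coefficients and of the perforated domain *)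

Lemma lipschitz_entry_continuous (R : realType) (d : nat)
    (A : 'rV[R]_d -> 'M[R]_d) i j :
  [lipschitz A y | y in setT] -> continuous (fun y => A y i j).
Proof.
move=> [M [_ hM]].
have M1 : M < `|M| + 1 by rewrite ltr_pwDr// ler_norm.
have K0 : 0 < `|M| + 1 by rewrite ltr_wpDl.
move: (`|M| + 1) K0 (hM _ M1) => K K0 {}hM y.
apply/(@cvgrPdist_lt _ _ _ (nbhs y) (nbhs_filter y)) => e e0.
have : \forall z \near y, `|y - z| < K^-1 * e.
  have := @cvgr_dist_lt _ _ _ (nbhs y) (nbhs_filter y) id y (fun _ h => h). apply.
  by rewrite mulr_gt0// invr_gt0.
apply: (@filterS _ (nbhs y) (nbhs_filter y)) => z hz.
have /= := hM (y, z) (conj I I).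
have : `|A y i j - A z i j| <= `|A y - A z|.
  rewrite [leRHS]/Num.norm/= mx_normrE.
  have := le_bigmax 0 (fun ij : 'I_d * 'I_d => `|(A y - A z) ij.1 ij.2|) (i, j).
  by rewrite /= !mxE.
move=> h1 h2; apply: (le_lt_trans (le_trans h1 h2)).
by rewrite -ltr_pdivlMl.
Qed.

Lemma coefficients_form (R : realType) (d : nat) (A : 'rV[R]_d -> 'M[R]_d)
    (glo gup eps : R) (x xi : 'rV[R]_d) : coefficients A glo gup ->
  0 < eps < 1 ->
  glo * dot xi xi <= dot (xi *m (A (eps^-1 *: x))^T) xi <= gup * dot xi xi.
Proof.
move=> [_ _ _ _ [_ _ hA]] he; rewrite quad_formE.
have := hA eps x xi he.
by rewrite /enorm sqr_sqrtr// dot_ge0.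
Qed.

(** The holes are indexed by integer vectors, hence countably many, and each is closed as the
    preimage of [hole] under the inverse of the affine map placing it. *)
Lemma perforated_measurable (R : realType) (d : nat) (Omega hole : set 'rV[R]_d)
    (eps : R) (I : set 'rV[int]_d) : 0 < eps -> open Omega -> closed hole ->
  measurable (perforated Omega hole eps I).
Proof.
move=> e0 oO ch; apply: measurableD; first exact: open_measurable_rV.
rewrite bigcup_mkcond; apply: countable_bigcupT_measurable => [|z].
  exact: countableP.
case: ifP => // _; apply: closed_measurable_rV.
rewrite (_ : copy eps z hole =
    (fun x => eps^-1 *: x - lattice z) @^-1` hole).
  apply: closed_comp => // x _; apply: continuousB; last exact: cst_continuous.
  exact: scaler_continuous.
apply/seteqP; split => x.
  by move=> [y hy <-] /=; rewrite scalerA mulVf ?gt_eqF// scale1r addrC addKr.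
move=> /= hx; exists (eps^-1 *: x - lattice z) => //.
by rewrite addrC subrK scalerA mulfV ?gt_eqF// scale1r.
Qed.

(** * Integrability of the terms of the scheme, and the estimate for two consecutive steps *)

Section energy.
Context (R : realType) (n : nat) (D : set 'rV[R]_n).
Context (mD : measurable D) (bD : bounded_set D).
Local Notation mu := (@lebesgue_rV R n).

(** The slope bound gives linear growth, |Fg(u)| <= |Fg(0)| + d1 |u|, and constants are
    square-integrable on a bounded set. *)
Lemma L2_comp_regularization (F : R -> R) (d0 d1 C sigma g : R) (Fg : R -> R)
    (u : 'rV[R]_n -> R) : 0 <= d0 -> 0 <= g ->
  regularization F d0 d1 C sigma g Fg -> L2 D u -> L2 D (fun x => Fg (u x)).
Proof.
move=> d00 g0 hF uL.
have iC : mu.-integrable D (EFin \o (fun=> 2 * Fg 0 ^+ 2)).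
  apply: measurable_bounded_integrable => //; first exact: mu_bounded.
  exact: bounded_cst.
have ig := integrableDr mD iC
  (integrableZr mD (2 * d1 ^+ 2) (L2_integrable_sqr mD uL)).
apply: (L2_mono mD _ ig).
  apply: (measurableT_comp _ (L2_measurable mD uL)).
  apply: continuous_measurable_fun; exact: regularization_continuous hF.
move=> x _; have [t /andP[t0 t1]] := regularization_slope (u x) 0 hF.
rewrite subr0 => E.
have t00 : 0 <= t by apply: le_trans t0; rewrite mulr_ge0.
have -> : Fg (u x) = Fg 0 + t * u x by rewrite -E addrC subrK.
have : t ^+ 2 * u x ^+ 2 <= d1 ^+ 2 * u x ^+ 2.
  by rewrite ler_wpM2r ?sqr_ge0// lerXn2r// nnegrE (le_trans t00).
have := sqr_ge0 (Fg 0 - t * u x); lra.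
Qed.

Context (B : 'rV[R]_n -> 'M[R]_n) (glo gup : R).
Context (mB : forall i j, measurable_fun D (fun x => B x i j))
  (sB : forall x, (B x)^T = B x)
  (hB : forall x xi, glo * dot xi xi <= dot (xi *m (B x)^T) xi <= gup * dot xi xi)
  (glo0 : 0 <= glo).

(** Ellipticity controls the form on the diagonal only; [dot_mulmx_bound] carries the control over
    to mixed arguments and supplies an integrable majorant. *)
Lemma integrable_form (G H : 'rV[R]_n -> 'rV[R]_n) :
  (forall i, L2 D (fun x => G x ord0 i)) ->
  (forall i, L2 D (fun x => H x ord0 i)) ->
  mu.-integrable D (EFin \o (fun x => dot (G x *m (B x)^T) (H x))).
Proof.
move=> GL HL.
have ig := integrableZr mD (gup / 2)
  (integrableDr mD (integrable_dot mD GL GL) (integrable_dot mD HL HL)).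
apply: le_integrable ig => //.
  apply/measurable_EFinP; apply: measurable_sum => i.
  apply: measurable_funM; last exact: (L2_measurable mD (HL i)).
  rewrite (_ : (fun x => _) = fun x => \sum_j G x ord0 j * B x i j).
    apply: measurable_sum => j; apply: measurable_funM => //.
    exact: (L2_measurable mD (GL j)).
  by apply/funext => x; rewrite mxE; apply: eq_bigr => j _; rewrite mxE.
move=> x _; rewrite /comp lee_fin; apply: le_trans (ler_norm _).
apply: dot_mulmx_bound => // z; have /andP[h1 ->] := hB x z.
by rewrite (le_trans _ h1)// mulr_ge0// dot_ge0.
Qed.

Lemma energy_estimate (F F1 F2 : R -> R) (d0 d1 C sigma g1 g2 M c : R)
    (f u0 u1 u2 : 'rV[R]_n -> R) (Du1 Du2 : 'rV[R]_n -> 'rV[R]_n) :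
  let v := fun x => u2 x - u1 x in
  let Dv := fun x => Du2 x - Du1 x in
  0 < d0 -> 0 < g2 <= g1 -> 0 < sigma -> 0 <= C -> 0 < c -> c * d1 <= M ->
  regularization F d0 d1 C sigma g1 F1 ->
  regularization F d0 d1 C sigma g2 F2 ->
  L2 D u0 -> L2 D u1 -> L2 D u2 ->
  (forall i, L2 D (fun x => Du1 x ord0 i)) ->
  (forall i, L2 D (fun x => Du2 x ord0 i)) ->
  \int[mu]_(x in D) dot (Du1 x *m (B x)^T) (Dv x)
    + M * \int[mu]_(x in D) (u1 x * v x) =
  \int[mu]_(x in D) (f x * v x) + M * \int[mu]_(x in D) (u0 x * v x)
    - c * \int[mu]_(x in D) (F1 (u0 x) * v x) ->
  \int[mu]_(x in D) dot (Du2 x *m (B x)^T) (Dv x)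
    + M * \int[mu]_(x in D) (u2 x * v x) =
  \int[mu]_(x in D) (f x * v x) + M * \int[mu]_(x in D) (u1 x * v x)
    - c * \int[mu]_(x in D) (F2 (u1 x) * v x) ->
  2 * glo * vnormL2 D Dv ^+ 2 + M * normL2 D v ^+ 2 <=
  M * normL2 D (fun x => u1 x - u0 x) ^+ 2 +
    4 * c * C ^+ 2 * fine (mu D) / d0 * (g1 `^ (2 * sigma) / g2).
Proof.
move=> v Dv d00 /andP[g20 g21] s0 C0 c0 cM hF1 hF2 u0L u1L u2L Du1L Du2L E1 E2.
have g10 : 0 < g1 by exact: lt_le_trans g21.
have vL : L2 D v by exact: L2B.
have DvL i : L2 D (fun x => Dv x ord0 i).
  rewrite (_ : (fun x => _) = fun x => Du2 x ord0 i - Du1 x ord0 i).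
    exact: L2B.
  by apply/funext => x; rewrite !mxE.
pose a x := u1 x - u0 x.
have aL : L2 D a by exact: L2B.
have F2L : L2 D (fun x => F2 (u1 x)).
  by apply: L2_comp_regularization hF2 u1L; exact: ltW.
have F1L : L2 D (fun x => F1 (u0 x)).
  by apply: L2_comp_regularization hF1 u0L; exact: ltW.
(* [Ha], [Hv] and [Hr] rewrite the integrals of differences through those occurring in [E1] and
   [E2]; the subtraction of the two equations is then left to linear arithmetic at the end. *)
have Ha : \int[mu]_(x in D) dot (Dv x *m (B x)^T) (Dv x) =
    \int[mu]_(x in D) dot (Du2 x *m (B x)^T) (Dv x) -
    \int[mu]_(x in D) dot (Du1 x *m (B x)^T) (Dv x).
  rewrite -RintegralB//; [|exact: integrable_form..].
  by apply: eq_Rintegral => x _; rewrite -dotNl -dotDl mulmxBl.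
have Hv : \int[mu]_(x in D) (v x ^+ 2) =
    \int[mu]_(x in D) (u2 x * v x) - \int[mu]_(x in D) (u1 x * v x).
  rewrite -RintegralB//; [|exact: L2_integrableM..].
  by apply: eq_Rintegral => x _; rewrite -mulrBl.
have Hr : \int[mu]_(x in D) ((M * a x - c * (F2 (u1 x) - F1 (u0 x))) * v x) =
    M * (\int[mu]_(x in D) (u1 x * v x) - \int[mu]_(x in D) (u0 x * v x))
    - c * (\int[mu]_(x in D) (F2 (u1 x) * v x) -
           \int[mu]_(x in D) (F1 (u0 x) * v x)).
  have ia := L2_integrableM mD aL vL.
  have iF := L2_integrableM mD (L2B mD F2L F1L) vL.
  have IB w1 w2 : L2 D w1 -> L2 D w2 ->
      \int[mu]_(x in D) (w1 x * v x) - \int[mu]_(x in D) (w2 x * v x) =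
      \int[mu]_(x in D) ((w1 x - w2 x) * v x).
    move=> w1L w2L; rewrite -RintegralB//; [|exact: L2_integrableM..].
    by apply: eq_Rintegral => x _; rewrite mulrBl.
  rewrite (IB _ _ u1L u0L) (IB _ _ F2L F1L).
  rewrite -!RintegralZl// -RintegralB//; [|exact: integrableZr..].
  by apply: eq_Rintegral => x _; rewrite mulrBl !mulrA.
(* h bounds c |F1 - F2|, both regularizations being within C g1^sigma of F because g2 <= g1. g is
   the least value of c t, for t a slope of [F2], and K is the resulting pointwise source. *)
pose h := 2 * c * C * g1 `^ sigma; pose g := c * (g2 * d0).
pose K := h ^+ 2 / (2 * g).
have g0 : 0 < g by rewrite !mulr_gt0.
have iv := L2_integrable_sqr mD vL; have ia := L2_integrable_sqr mD aL.
have iK : mu.-integrable D (EFin \o (fun=> K)).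
  apply: measurable_bounded_integrable => //; first exact: mu_bounded.
  exact: bounded_cst.
have iva := integrableDr mD (integrableZr mD (M / 2) iv)
  (integrableZr mD (M / 2) ia).
have le1 : \int[mu]_(x in D) ((M * a x - c * (F2 (u1 x) - F1 (u0 x))) * v x) <=
    M / 2 * \int[mu]_(x in D) (v x ^+ 2) + M / 2 * \int[mu]_(x in D) (a x ^+ 2)
    + K * fine (mu D).
  rewrite -Rintegral_cst// -!RintegralZl// -RintegralD//; [|exact: integrableZr..].
  rewrite -RintegralD//; apply: le_Rintegral => //.
  - apply: L2_integrableM => //; apply: L2B => //; apply: L2Z => //.
    exact: L2B.
  - exact: integrableDr.
  move=> x _.
  have [t /andP[t0 t1] Et] := regularization_slope (u1 x) (u0 x) hF2.
  (* Only [F2] is evaluated at two points, which costs a slope; [F1] and [F2] are then compared at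
     the same point u0. *)
  have -> : M * a x - c * (F2 (u1 x) - F1 (u0 x)) =
      (M - c * t) * a x + c * (F1 (u0 x) - F2 (u0 x)).
    have -> : F2 (u1 x) = F2 (u0 x) + t * a x by rewrite -Et addrC subrK.
    by ring.
  have ct0 : g <= c * t by rewrite ler_pM2l.
  have ct1 : c * t <= c * d1 by rewrite ler_pM2l.
  (* Here p = M - c t: it is nonnegative as c t <= c d1 <= M, and p + g <= M as g <= c t. *)
  apply: young_split => //; [lra|lra|].
  rewrite normrM gtr0_norm// /h [2 * c]mulrC -2!mulrA ler_pM2l//.
  have [_ _ _ A1] := hF1 (u0 x); have [_ _ _ A2] := hF2 (u0 x).
  have : C * g2 `^ sigma <= C * g1 `^ sigma.
    by rewrite ler_wpM2l// ge0_ler_powR// ?nnegrE ltW.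
  have := ler_distD (F (u0 x)) (F1 (u0 x)) (F2 (u0 x)).
  rewrite (distrC (F1 (u0 x)) (F (u0 x))); lra.
have le2 : glo * vnormL2 D Dv ^+ 2 <=
    \int[mu]_(x in D) dot (Dv x *m (B x)^T) (Dv x).
  rewrite vnormL2_sqr -RintegralZl//; last exact: integrable_dot.
  apply: le_Rintegral => //; last by move=> x _; have /andP[] := hB x (Dv x).
    by apply: integrableZr => //; exact: integrable_dot.
  exact: integrable_form.
(* Doubling clears the halves left by Young's inequality. Of the c^2 in h^2, one factor cancels
   against g. *)
have EK : 2 * (K * fine (mu D)) =
    4 * c * C ^+ 2 * fine (mu D) / d0 * (g1 `^ (2 * sigma) / g2).
  have -> : g1 `^ (2 * sigma) = (g1 `^ sigma) ^+ 2.
    by rewrite mulrC powRrM powR_mulrn// powR_ge0.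
  rewrite /K /h /g; field; rewrite !gt_eqF//.
rewrite -EK -/a (normL2_sqr _ v) (normL2_sqr _ a).
move: le1 le2; rewrite Hr Ha Hv; move: E1 E2.
move: (vnormL2 D Dv) (K * fine (mu D)) (\int[mu]_(x in D) (a x ^+ 2)) => p k i2; lra.
Qed.

End energy.

(** * Contraction and iteration *)

(** The bound is on q * N k because the last step of the theorem also carries the gradient term:
    that step is used once as it stands, and the q * N k it leaves is unrolled here. *)
Lemma geometric_recurrence (R : realType) (N T : nat -> R) (q C : R) :
  0 <= q -> (forall k, (2 <= k)%N -> N k <= q * N k.-1 + C * T k) ->
  forall k, (1 <= k)%N -> q * N k <=
    C * (\sum_(2 <= j < k.+1) q ^+ (k.+1 - j)%N * T j) + N 1%N * q ^+ k.
Proof.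
move=> q0 NT; elim=> // -[|k] IH _.
  by rewrite big_geq// mulr0 add0r expr1 mulrC.
have {IH} := IH isT; have := NT k.+2 isT; rewrite /= => h IH.
apply: (le_trans (ler_wpM2l q0 h)).
rewrite (@big_nat_recr _ _ _ k.+2)//= subSnn expr1.
(* Passing to the next index multiplies every older term by q. *)
have -> : \sum_(2 <= j < k.+2) q ^+ (k.+3 - j)%N * T j =
    q * \sum_(2 <= j < k.+2) q ^+ (k.+2 - j)%N * T j.
  rewrite mulr_sumr; apply: eq_big_nat => j /andP[_ jk].
  by rewrite mulrA -exprS subSn// ltnW.
have := ler_wpM2l q0 IH; rewrite [q ^+ k.+2]exprS.
move: (\sum_(_ <= _ < _) _) => S; lra.
Qed.

(** Poincare's inequality trades one of the two copies of glo P for (glo / Cp) V, and division by s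
    = glo / Cp + M gives the contraction. Replacing s by S in the gradient coefficient and by glo /
    Cp under K leaves constants free of M; the added 1 makes the source coefficient positive even if
    K = 0. *)
Lemma contraction_step (R : realType) (glo Cp M S K P V W T : R) :
  0 < glo -> 0 < Cp -> 0 < M -> M + glo / Cp <= S -> 0 <= K -> 0 <= P ->
  0 <= T -> V <= Cp * P -> 2 * glo * P + M * V <= M * W + K * T ->
  glo / S * P + V <= M / (glo / Cp + M) * W + (K / (glo / Cp) + 1) * T.
Proof.
move=> glo0 Cp0 M0 sS K0 P0 T0 VP E.
have r0 : 0 < glo / Cp by exact: divr_gt0.
move: sS; rewrite [M + _]addrC; set s := _ + M => sS.
have s0 : 0 < s by exact: addr_gt0.
have h1 : glo / S * P <= glo / s * P.
  by rewrite ler_wpM2r// ler_pM2l// lef_pV2// posrE (lt_le_trans s0).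
have h2 : K / s * T <= (K / (glo / Cp) + 1) * T.
  rewrite ler_wpM2r// ler_wpDr// ler_wpM2l// lef_pV2// ?posrE//.
  by rewrite lerDl ltW.
have h3 : glo / Cp * V <= glo * P.
  by rewrite mulrAC ler_pdivrMr// -mulrA ler_pM2l// mulrC.
suff : glo / s * P + V <= M / s * W + K / s * T by lra.
have -> : glo / s * P + V = (glo * P + s * V) / s by field; rewrite gt_eqF.
have -> : M / s * W + K / s * T = (M * W + K * T) / s by field; rewrite gt_eqF.
by rewrite ler_pM2r ?invr_gt0// /s mulrDl; lra.
Qed.

Theorem theorem2 (R : realType) (d : nat) (hd : d = 2%N \/ d = 3%N)
  (Omega hole : set 'rV[R]_d) (hOmega : polyhedral_domain Omega)
  (hhole : is_hole hole)
  (I : R -> set 'rV[int]_d)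
  (hI : forall eps : R, 0 < eps < 1 -> perforation Omega hole eps (I eps))
  (Cp : R) (hCp : 0 < Cp)
  (poincare : forall eps : R, 0 < eps < 1 ->
    forall (u : 'rV[R]_d -> R) (Du : 'rV[R]_d -> 'rV[R]_d),
    H1_zero_on (boundary Omega) (perforated Omega hole eps (I eps)) u Du ->
    normL2 (perforated Omega hole eps (I eps)) u ^+ 2
      <= Cp * vnormL2 (perforated Omega hole eps (I eps)) Du ^+ 2)
  (alpha : R) (halpha : 0 <= alpha)
  (A : 'rV[R]_d -> 'M[R]_d) (glo gup : R) (hA1 : coefficients A glo gup)
  (Rea : R -> R) (delta0 delta1 : R)
  (hA2 : exists x0 : R, degenerate_at Rea x0 delta0 delta1)
  (f : 'rV[R]_d -> R) (hA3 : L2 Omega f)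
  (gam : nat -> R)
  (gam_gt0 : forall k : nat, (1 <= k)%N -> 0 < gam k)
  (gam_noninc : forall j k : nat, (1 <= j <= k)%N -> gam k <= gam j)
  (Creg sigma : R) (hCreg : 0 < Creg) (hsigma : 0 < sigma)
  (Rreg : R -> R -> R)
  (hRreg : forall k : nat, (1 <= k)%N ->
    regularization Rea delta0 delta1 Creg sigma (gam k) (Rreg (gam k)))
  (eta : R) (heta : 0 < eta) :
  exists C : R, 0 < C /\
  forall eps : R, 0 < eps < 1 ->
  let Oe := perforated Omega hole eps (I eps) in
  let M := eta + eps `^ alpha * delta1 in
  let q := M / (glo * Cp^-1 + M) in
  forall (u : nat -> 'rV[R]_d -> R) (Du : nat -> 'rV[R]_d -> 'rV[R]_d),
  iterates Oe (H1_zero_on (boundary Omega) Oe) (fun x => A (eps^-1 *: x)) f M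
    (eps `^ alpha) (fun k => Rreg (gam k)) u Du ->
  forall k : nat, (2 <= k)%N ->
  glo / (eta + delta1 + glo * Cp^-1)
      * vnormL2 Oe (fun x => Du k x - Du k.-1 x) ^+ 2
    + normL2 Oe (fun x => u k x - u k.-1 x) ^+ 2
  <= C * gam k.-1 `^ (2 * sigma) / gam k
     + C * \sum_(2 <= j < k)
             q ^+ (k - j)%N * (gam j.-1 `^ (2 * sigma) / gam j)
     + normL2 Oe (u 1%N) ^+ 2 * q ^+ k.-1.
Proof.
have [oO _ _ bO _] := hOmega; have [_ _ ch _] := hhole.
have [x0 [d00 d10 _ _ _]] := hA2.
have [_ _ sA lA [glo0 gup0 _]] := hA1.
have mO := open_measurable_rV oO.
have gC0 : 0 < glo * Cp^-1 by rewrite mulr_gt0// invr_gt0.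
(* The measure of [Omega] dominates that of every perforated domain, and eps^alpha <= 1, so K can be
   chosen independently of eps. *)
pose muO := fine (lebesgue_rV d Omega).
have muO0 : 0 <= muO by exact: fine_ge0.
pose K := 4 * Creg ^+ 2 * muO / delta0.
have K0 : 0 <= K by rewrite !mulr_ge0// ?invr_ge0 ltW.
exists (K / (glo * Cp^-1) + 1); split.
  by rewrite ltr_wpDl// mulr_ge0// invr_ge0 ltW.
move=> eps he Oe M q u Du [u0 hu] k k2.
have /andP[e0 e1] := he.
have mOe : measurable Oe by exact: perforated_measurable.
have [_ _ [bOe _ _ _]] := hI eps he.
have muOe0 : 0 <= fine (lebesgue_rV d Oe) by exact: fine_ge0.
have muOe : fine (lebesgue_rV d Oe) <= muO.
  rewrite fine_le// ?ge0_fin_numE//; try exact: mu_bounded.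
  by apply: le_measure; rewrite ?inE//; exact: subDsetl.
pose c := eps `^ alpha.
have c0 : 0 < c by exact: powR_gt0.
have c1 : c <= 1.
  have -> : 1 = 1 `^ alpha :> R by rewrite powR1.
  by rewrite ge0_ler_powR// ?nnegrE ltW.
have M0 : 0 < M by rewrite addr_gt0// mulr_gt0.
have cM : c * delta1 <= M by rewrite lerDr ltW.
have q0 : 0 <= q by apply: divr_ge0; apply: ltW => //; exact: addr_gt0.
pose Bm := fun x : 'rV[R]_d => A (eps^-1 *: x).
have mB i j : measurable_fun Oe (fun x => Bm x i j).
  have cB : continuous ((fun y => A y i j) \o (fun x => eps^-1 *: x)).
    move=> x; apply: continuous_comp; first exact: scaler_continuous.
    exact: lipschitz_entry_continuous.
  by apply: measurable_funTS; exact: continuous_measurable_rV cB.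
have hV m : (1 <= m)%N -> H1_zero_on (boundary Omega) Oe (u m) (Du m).
  by move=> /hu[].
have uL m : L2 Oe (u m).
  case: m => [|m]; first by rewrite u0; apply: L2_continuous => //; exact: cst_continuous.
  by have [[]] := hV m.+1 isT.
(* [iterates] prescribes u 0 but says nothing of [Du 0], whence the restriction to m >= 1. *)
have DuL m i : (1 <= m)%N -> L2 Oe (fun x => Du m x ord0 i).
  by move=> /hV[[_ h _] _]; exact: h.
pose v m := fun x => u m x - u m.-1 x.
pose Dv m := fun x => Du m x - Du m.-1 x.
pose T m := gam m.-1 `^ (2 * sigma) / gam m.
have step m : (2 <= m)%N ->
    glo / (eta + delta1 + glo * Cp^-1) * vnormL2 Oe (Dv m) ^+ 2
      + normL2 Oe (v m) ^+ 2 <=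
    q * normL2 Oe (v m.-1) ^+ 2 + (K / (glo * Cp^-1) + 1) * T m.
  (* From index 2 on, both of the consecutive iterates solve an equation. *)
  case: m => [|[|m]]// _ /=.
  have vV : H1_zero_on (boundary Omega) Oe (v m.+2) (Dv m.+2).
    by apply: H1_zero_onB => //; exact: hV.
  have gm2 : 0 < gam m.+2 <= gam m.+1 by rewrite gam_gt0// gam_noninc/=.
  have [_ E1] := hu m.+1 isT; have [_ E2] := hu m.+2 isT.
  have := energy_estimate mOe bOe mB (fun x => sA _)
    (fun x xi => coefficients_form x xi hA1 he) (ltW glo0) d00 gm2 hsigma
    (ltW hCreg) c0 cM (hRreg m.+1 isT) (hRreg m.+2 isT)
    (uL m) (uL m.+1) (uL m.+2) (fun i => DuL m.+1 i isT)
    (fun i => DuL m.+2 i isT) (E1 _ _ vV) (E2 _ _ vV).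
  rewrite -/(v m.+2) -/(Dv m.+2) -/(v m.+1) -/(T m.+2).
  have T0 : 0 <= T m.+2.
    by rewrite mulr_ge0 ?powR_ge0// invr_ge0 ltW// gam_gt0.
  have := poincare eps he _ _ vV.
  rewrite -/Oe => VP E; apply: contraction_step => //.
  (* M <= eta + delta1, because eps^alpha <= 1. *)
  - by rewrite lerD2r lerD2l ler_piMl// ltW.
  - exact: sqr_ge0.
  - apply: (le_trans E); rewrite lerD2l; apply: ler_wpM2r => //.
    apply: ler_wpM2r; first by rewrite invr_ge0 ltW.
    apply: ler_pM => //; first by rewrite !mulr_ge0// ltW.
    by rewrite ler_pM2r ?exprn_gt0// ler_piMr.
have main := step k k2.
rewrite -/(v k) -/(Dv k).
apply: (le_trans main).
(* Below the top index the gradient term is dropped, which leaves a scalar recurrence. *)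
have NT m : (2 <= m)%N -> normL2 Oe (v m) ^+ 2 <=
    q * normL2 Oe (v m.-1) ^+ 2 + (K / (glo * Cp^-1) + 1) * T m.
  move=> /step; apply: le_trans; rewrite lerDr mulr_ge0 ?sqr_ge0//.
  by rewrite divr_ge0 ?addr_ge0 ?ltW.
case: k k2 main => [|[|k]]// _ _ /=.
have := geometric_recurrence q0 NT (isT : (1 <= k.+1)%N).
have -> : normL2 Oe (v 1%N) = normL2 Oe (u 1%N).
  (* The zero initial guess turns the first increment into u 1. *)
  by congr normL2; apply/funext => x; rewrite /v/= u0 subr0.
rewrite -!mulrA -/(T k.+2) => /= h.
rewrite addrC -addrA lerD2l.
exact: h.
Qed.
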